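(* Fix $q\ge2$. For $N\ge1$ let $G_N$ be the graph with vertex set $V_1\cup V_2$, $V_1=\{u_1,\dots,u_{q-1}\}$, $V_2=\{w_1,\dots,w_N\}$ (disjoint), whose edges are all pairs $(u_i,u_j)$ with $1\le i<j\le q-1$ and all pairs $(u_i,w_j)$ with $1\le i\le q-1$, $1\le j\le N$. (This sequence has bounded average degree.) Consider the $q$-coloring model on $G_N$. Then: (a) for every $\boldsymbol\beta\in\mathbb{R}^{q-1}$ with $\beta_1<0$ and every $\varepsilon\in(0,1)$, $\limsup_{N\to\infty}\mathbb{P}^N_{\boldsymbol\beta}(|\mathcal{U}^N_1(\vec\sigma)|>\varepsilon N)=0$; (b) for every $r\in\{1,\dots,q-1\}$, consistent estimation of $\boldsymbol\beta$ is impossible when $\beta_r<0$: there is no sequence of estimates $\check{\boldsymbol\beta}^N=\check{\boldsymbol\beta}^N(\vec\sigma)\in\mathbb{R}^{q-1}$, based on a single sample $\vec\sigma\sim\mathbb{P}^N_{\boldsymbol\beta}$, that converges in probability to $\boldsymbol\beta$ under $\mathbb{P}^N_{\boldsymbol\beta}$ for all $\boldsymbol\beta\in\mathbb{R}^{q-1}$ with $\beta_r<0$.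
   Context: The $q$-coloring model on a finite simple graph $G_N$ with parameter $\boldsymbol\beta=(\beta_1,\dots,\beta_{q-1})\in\mathbb{R}^{q-1}$ is the probability measure on proper colorings $\vec\sigma$ of $G_N$ with colors $\{0,1,\dots,q-1\}$ given by $\mathbb{P}^N_{\boldsymbol\beta}(\vec\sigma)\propto\exp\{\sum_{s=1}^{q-1}\beta_s c^N_s(\vec\sigma)\}$, where $c^N_s(\vec\sigma)$ is the number of vertices with color $s$ (so $\beta_0=0$). $\mathcal{U}^N_r(\vec\sigma)$ is the set of vertices $u$ of $G_N$ such that no neighbor of $u$ in $G_N$ has color $r$ in $\vec\sigma$. *)

(* Defs.v *)
From HB Require Import structures.
From mathcomp Require Import all_boot all_order all_algebra.
From mathcomp Require Import all_classical all_reals all_analysis.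
Set Implicit Arguments.
Unset Strict Implicit.
Unset Printing Implicit Defensive.
Import Order.TTheory GRing.Theory Num.Theory.
Import numFieldNormedType.Exports.
Local Open Scope ring_scope.

Record sgraph := SGraph {
  vertex :> finType;
  adj : rel vertex;
  adj_sym : symmetric adj;
  adj_irr : irreflexive adj }.

Definition avg_degree (R : realType) (G : sgraph) : R :=
  (\sum_(u : G) #|[set v : G | adj u v]|)%:R / #|G|%:R.

(* Colors 0, ..., q-1 are the elements of 'I_q. *)
Definition is_proper (G : sgraph) (q : nat) (f : {ffun G -> 'I_q}) : bool :=
  [forall u, forall v, adj u v ==> (f u != f v)].

Definition coloring (G : sgraph) (q : nat) : Type :=
  {f : {ffun G -> 'I_q} | is_proper f}.

HB.instance Definition _ G q := SubFinite.on (coloring G q).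

Section Model.
Variables (R : realType) (G : sgraph) (q : nat).
Implicit Types (beta : 'rV[R]_q.-1) (sigma : coloring G q).

Definition color sigma (u : G) : 'I_q := val sigma u.

Definition color_count (s : nat) sigma : nat :=
  #|[set u : G | color sigma u == s :> nat]|.

(* U_r(sigma): a vertex is not its own neighbor, so u itself may have color r. *)
Definition unblocked (r : nat) sigma : {set G} :=
  [set u : G | [forall v, adj u v ==> (color sigma v != r :> nat)]].

(* The coordinates beta_1, ..., beta_{q-1} are stored at the indices
   0, ..., q-2 of the row vector; beta_0 = 0. *)
Definition coef beta (s : nat) : R :=
  if s is t.+1 then oapp (fun i : 'I_q.-1 => beta 0 i) 0 (insub t) else 0.

Definition weight beta sigma : R :=
  expR (\sum_(1 <= s < q) coef beta s * (color_count s sigma)%:R).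

Definition partition_fun beta : R := \sum_(sigma : coloring G q) weight beta sigma.

(* Probability of an event under the q-coloring model; a probability measure
   as soon as G has a proper q-coloring. *)
Definition Prob beta (E : pred (coloring G q)) : R :=
  (\sum_(sigma | E sigma) weight beta sigma) / partition_fun beta.

End Model.

(* Complete join of a clique on q-1 vertices (inl) with N isolated ones (inr). *)
Section CliqueJoin.
Variables q N : nat.

Definition clique_join_adj : rel ('I_q.-1 + 'I_N)%type := fun x y =>
  match x, y with
  | inl i, inl j => i != j
  | inl _, inr _ | inr _, inl _ => true
  | inr _, inr _ => false
  end.

Lemma clique_join_sym : symmetric clique_join_adj.
Proof. by move=> [i|i] [j|j] //=; rewrite eq_sym. Qed.

Lemma clique_join_irr : irreflexive clique_join_adj.
Proof. by move=> [i|i] //=; rewrite eqxx. Qed.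

Definition clique_join : sgraph := SGraph clique_join_sym clique_join_irr.

End CliqueJoin.

(* Convergence in probability of est N to beta under P^N_beta along a sequence
   of graphs; `|_| is the sup norm on R^(q-1). *)
Definition consistent_at (R : realType) (q : nat) (G : nat -> sgraph)
    (est : forall N, coloring (G N) q -> 'rV[R]_q.-1) (beta : 'rV[R]_q.-1) : Prop :=
  forall eps : R, 0 < eps ->
    ((fun N => Prob beta (fun sigma : coloring (G N) q =>
        eps < `|est N sigma - beta|)) @ \oo --> (0 : R))%classic.

(* Main.v *)
(* The clique uses q-1 colors and every leaf must take the remaining one, so the
   number of proper colorings is at most q^(q-1) whatever N is, and a coloring
   with leaf color r has weight of order exp(N beta_r). A large unblocked set for
   color r forces leaf color r, whose probability is O(exp(N beta_r)) relative to
   leaf color 0. When beta <= 0, a single coloring with leaf color 0 has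
   probability bounded below uniformly in N, so two distinct parameters beta <= 0
   cannot be told apart. *)
Require Import Defs.
From mathcomp Require Import all_boot all_order all_algebra.
From mathcomp Require Import all_classical all_reals all_analysis.
From mathcomp Require Import zify lra.
Import Order.TTheory GRing.Theory Num.Theory.
Import numFieldNormedType.Exports.
Local Open Scope ring_scope.

Lemma color_adj_neq {G : sgraph} {q : nat} (sigma : coloring G q) (u v : G) :
  adj u v -> color sigma u != color sigma v.
Proof. by move: (valP sigma) => /forallP/(_ u)/forallP/(_ v)/implyP. Qed.

(** * Structure of the proper colorings of the clique join *)

Section CliqueJoinColorings.
Context {q N : nat}.
Hypothesis hq : (2 <= q)%N.
Implicit Types sigma tau : coloring (clique_join q N) q.

Let clique (i : 'I_q.-1) : clique_join q N := inl i.
Let leaf (j : 'I_N) : clique_join q N := inr j.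

Lemma clique_color_inj sigma : injective (fun i => color sigma (clique i)).
Proof.
move=> i j /eqP; case: (eqVneq i j) => // ij.
by rewrite (negbTE (color_adj_neq sigma (clique i) (clique j) ij)).
Qed.

(* The clique uses q-1 distinct colors and a leaf takes the only other one. *)
Lemma clique_color_cover sigma (j : 'I_N) (c : 'I_q) :
  c != color sigma (leaf j) -> exists i, color sigma (clique i) = c.
Proof.
move=> cj; set A := [set color sigma (clique i) | i in 'I_q.-1].
suff /imsetP[i _ ->] : c \in A by exists i.
have jA : color sigma (leaf j) \notin A.
  apply/imsetP => -[i _] /eqP; apply/negP.
  exact: (color_adj_neq sigma (leaf j) (clique i)).
have cardA : #|color sigma (leaf j) |: A| = q.
  by rewrite cardsU1 jA card_imset ?card_ord; [lia | exact: clique_color_inj].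
have : color sigma (leaf j) |: A = [set: 'I_q].
  by apply/eqP; rewrite eqEcard finset.subsetT cardA cardsT card_ord leqnn.
by move/setP/(_ c); rewrite !inE (negbTE cj).
Qed.

(** A leaf sees the whole clique, so its color is the only one missing there and is determined by
    the clique colors. *)
Lemma coloring_clique_inj :
  injective (fun sigma => [ffun i => color sigma (clique i)]).
Proof.
move=> sigma tau /ffunP st.
have cl i : color sigma (clique i) = color tau (clique i).
  by have := st i; rewrite !ffunE.
apply/val_inj/ffunP => -[i|j]; first exact: cl.
apply/eqP/negPn/negP => neq.
have [i ci] := clique_color_cover tau j (color sigma (leaf j)) neq.
have := color_adj_neq sigma (leaf j) (clique i) isT.
by rewrite cl ci eqxx.
Qed.

Lemma card_coloring : (#|{: coloring (clique_join q N) q}| <= q ^ q.-1)%N.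
Proof.
by have := leq_card _ coloring_clique_inj; rewrite card_ffun !card_ord.
Qed.

(** Only clique vertices can then have color [s], and their colors are pairwise distinct. *)
Lemma color_count_le1 sigma (s : nat) :
  (forall j, color sigma (leaf j) != s :> nat) -> (color_count s sigma <= 1)%N.
Proof.
move=> ls; apply/card_le1_eqP => -[i|j] y; last by rewrite !inE (negbTE (ls j)).
rewrite inE => /eqP si; case: y => [i'|j]; rewrite !inE; last first.
  by rewrite (negbTE (ls j)).
move=> /eqP si'; congr inl; apply: (clique_color_inj sigma).
by apply: val_inj; rewrite /= si.
Qed.

Lemma color_count_leaves sigma (s : nat) :
  (forall j, color sigma (leaf j) = s :> nat) -> (N <= color_count s sigma)%N.
Proof.
move=> ls; rewrite -[leqLHS](card_ord N) -(card_imset _ (@inr_inj 'I_q.-1 'I_N)).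
apply/subset_leq_card/fintype.subsetP => _ /imsetP[j _ ->].
by rewrite inE; apply/eqP/ls.
Qed.

(* Any other color of the leaves puts color r on a clique vertex, which is
   adjacent to everything else and so leaves only itself unblocked. *)
Lemma leaf_color_of_unblocked sigma (r : nat) : (r < q)%N ->
  (1 < #|unblocked r sigma|)%N -> forall j, color sigma (leaf j) = r :> nat.
Proof.
move=> rq U j; apply/eqP/negPn/negP => jr; move: U; apply/negP; rewrite -leqNgt.
have [|i ci] := clique_color_cover sigma j (Ordinal rq).
  by apply: contraNneq jr => <-.
have ui u : u \in unblocked r sigma -> u = clique i.
  rewrite inE => /forallP/(_ (clique i)); rewrite ci /= eqxx implybF.
  by case: u => [k|//] /negPn/eqP ->.
by apply/card_le1_eqP => u v /ui -> /ui ->.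
Qed.

(** This coloring bounds the partition function from below and is the common witness against
    consistency at two parameters. *)
Lemma exists_coloring_leaf0 :
  exists sigma, forall j, color sigma (leaf j) = 0 :> nat.
Proof.
have q0 : (0 < q)%N by lia.
have qS (i : 'I_q.-1) : (i.+1 < q)%N by have := ltn_ord i; lia.
pose f : {ffun clique_join q N -> 'I_q} := [ffun u : clique_join q N =>
  if u is inl i then Ordinal (qS i) else Ordinal q0].
have fP : is_proper f.
  apply/forallP => u; apply/forallP => v; apply/implyP; rewrite !ffunE.
  by case: u v => [i|j] [i'|j'].
by exists (exist _ f fP) => j; rewrite /color /= ffunE.
Qed.

End CliqueJoinColorings.

(** * Bounds on weights and probabilities with explicit dependence on [N] *)

Section GibbsBounds.
Context {R : realType} {q N : nat}.
Hypothesis hq : (2 <= q)%N.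
Implicit Types (beta : 'rV[R]_q.-1) (sigma : coloring (clique_join q N) q).

Let leaf (j : 'I_N) : clique_join q N := inr j.

(** Each color occurs at most once on the clique, so this bounds the clique's share of the exponent
    in absolute value. *)
Definition coef_norm1 beta : R := \sum_(1 <= s < q) `|coef beta s|.

Lemma weight_gt0 beta sigma : 0 < weight beta sigma.
Proof. exact: expR_gt0. Qed.

(** Leaves of color 0 add nothing to the exponent, so the bound is free of [N]. *)
Lemma weight_ge_leaf0 beta sigma :
  (forall j, color sigma (leaf j) = 0 :> nat) ->
  expR (- coef_norm1 beta) <= weight beta sigma.
Proof.
move=> l0; rewrite ler_expR /coef_norm1 -sumrN.
apply: ler_sum_nat => s /andP[s1 _].
have /(color_count_le1) cs j : color sigma (leaf j) != s :> nat.
  by rewrite l0; lia.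
apply: (@le_trans _ _ (- (`|coef beta s| * (color_count s sigma)%:R))).
  by rewrite lerN2 ler_piMr // lern1.
by rewrite -mulNr ler_wpM2r // lerNl -normrN ler_norm.
Qed.

Lemma weight_le1 beta sigma :
  (forall s, coef beta s <= 0) -> weight beta sigma <= 1.
Proof.
move=> b0; rewrite -[leRHS]expR0 ler_expR sumr_le0 // => s _.
by rewrite mulr_le0_ge0.
Qed.

Lemma weight_le_leaf beta sigma (r : nat) : (1 <= r < q)%N -> coef beta r <= 0 ->
  (forall j, color sigma (leaf j) = r :> nat) ->
  weight beta sigma <= expR (coef_norm1 beta) * expR (coef beta r) ^+ N.
Proof.
move=> rq br lr; rewrite -expRM_natr -expRD ler_expR.
(* Color [r] is split off: its count is at least [N] and its coefficient nonpositive. Every other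
   color occurs at most once and is absorbed by the norm. *)
rewrite /coef_norm1 !(bigD1_seq r) ?mem_index_iota ?iota_uniq //=.
rewrite addrC lerD //; last first.
  by rewrite ler_wnM2l // ler_nat color_count_leaves.
rewrite -[leLHS]add0r lerD // ler_sum // => s sr.
have /(color_count_le1) cs j : color sigma (leaf j) != s :> nat.
  by rewrite lr eq_sym.
apply: (@le_trans _ _ (`|coef beta s| * (color_count s sigma)%:R)).
  by rewrite ler_wpM2r // ler_norm.
by rewrite ler_piMr // lern1.
Qed.

Lemma partition_fun_ge beta : expR (- coef_norm1 beta) <= partition_fun (clique_join q N) beta.
Proof.
have [sigma l0] := @exists_coloring_leaf0 q N hq.
apply: (le_trans (weight_ge_leaf0 beta sigma l0)).
rewrite /partition_fun (bigD1 sigma) //= lerDl sumr_ge0 // => ? _.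
exact/ltW/weight_gt0.
Qed.

Lemma Prob_ge0 beta (E : pred (coloring (clique_join q N) q)) : 0 <= Prob beta E.
Proof.
apply: divr_ge0; first by apply: sumr_ge0 => ? _; exact/ltW/weight_gt0.
exact: le_trans (expR_ge0 _) (partition_fun_ge beta).
Qed.

Lemma sum_weight_le beta (E : pred (coloring (clique_join q N) q)) (M : R) :
  0 <= M -> (forall sigma, E sigma -> weight beta sigma <= M) ->
  \sum_(sigma | E sigma) weight beta sigma <= (q ^ q.-1)%:R * M.
Proof.
move=> M0 EM; apply: (le_trans (ler_sum _ EM)).
rewrite sumr_const -[leLHS]mulr_natl ler_wpM2r // ler_nat.
exact: leq_trans (max_card _) (card_coloring hq).
Qed.

Lemma Prob_unblocked_le beta (r : nat) (E : pred (coloring (clique_join q N) q)) :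
  (1 <= r < q)%N -> coef beta r <= 0 ->
  (forall sigma, E sigma -> (1 < #|unblocked r sigma|)%N) ->
  Prob beta E <=
    (q ^ q.-1)%:R * expR (coef_norm1 beta) / expR (- coef_norm1 beta) *
      expR (coef beta r) ^+ N.
Proof.
move=> rq br EU; rewrite mulrAC; apply: ler_pM.
- by apply: sumr_ge0 => ? _; exact/ltW/weight_gt0.
- by rewrite invr_ge0 (le_trans (expR_ge0 _) (partition_fun_ge beta)).
- rewrite -mulrA; apply: sum_weight_le => [|sigma /EU U].
    by rewrite mulr_ge0 ?exprn_ge0 ?expR_ge0.
  apply: weight_le_leaf => //; apply: (leaf_color_of_unblocked hq) => //.
  by case/andP: rq.
- by rewrite lef_pV2 ?posrE ?expR_gt0 ?partition_fun_ge //
     (lt_le_trans (expR_gt0 _) (partition_fun_ge beta)).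
Qed.

(** Nonpositive coefficients make every weight at most 1, so the partition function is at most the
    bound on the number of colorings. *)
Lemma Prob_leaf0_ge beta (E : pred (coloring (clique_join q N) q)) sigma :
  (forall s, coef beta s <= 0) ->
  (forall j, color sigma (leaf j) = 0 :> nat) -> E sigma ->
  expR (- coef_norm1 beta) / (q ^ q.-1)%:R <= Prob beta E.
Proof.
move=> b0 l0 Es; apply: ler_pM; rewrite ?expR_ge0 ?invr_ge0 ?ler0n //.
  apply: (le_trans (weight_ge_leaf0 beta sigma l0)).
  rewrite (bigD1 sigma) //= lerDl sumr_ge0 // => ? _.
  exact/ltW/weight_gt0.
rewrite lef_pV2 ?posrE ?ltr0n ?expn_gt0 ?(ltnW hq) //.
  rewrite -[leRHS]mulr1; apply: sum_weight_le => // ? _; exact: weight_le1.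
exact: lt_le_trans (expR_gt0 _) (partition_fun_ge beta).
Qed.

End GibbsBounds.

(** * Average degree and limits as [N] grows *)

Section Asymptotics.
Variables (R : realType) (q : nat).
Hypothesis hq : (2 <= q)%N.
Implicit Types beta : 'rV[R]_q.-1.

(** The q-1 clique vertices have degree at most |V| and the leaves at most q-1, so each kind
    contributes at most (q-1)|V| to the degree sum. *)
Lemma avg_degree_clique_join_le (N : nat) :
  avg_degree R (clique_join q N) <= (q.-1 * 2)%:R.
Proof.
rewrite /avg_degree ler_pdivrMr; last by rewrite ltr0n card_sum !card_ord; lia.
rewrite -natrM ler_nat big_sumType /=.
have -> : (q.-1 * 2 * #|clique_join q N| =
    q.-1 * #|clique_join q N| + q.-1 * #|clique_join q N|)%N.
  by rewrite -mulnA mul2n -addnn mulnDr.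
apply: leq_add.
  rewrite -[X in (_ <= X * _)%N]card_ord -sum_nat_const.
  by apply: leq_sum => i _; exact: max_card.
apply: (@leq_trans (\sum_(j < N) q.-1)).
  apply: leq_sum => j _; rewrite -[leqRHS]card_ord.
  rewrite -[leqRHS](card_imset _ (@inl_inj 'I_q.-1 'I_N)).
  apply/subset_leq_card/fintype.subsetP => -[i|k]; last by rewrite inE.
  by rewrite imset_f.
by rewrite sum_nat_const card_sum !card_ord mulnC leq_mul2l leq_addl orbT.
Qed.

Lemma Prob_unblocked_cvg0 beta (r : nat) (eps : R) :
  (1 <= r < q)%N -> coef beta r < 0 -> 0 < eps ->
  ((fun N => Prob beta (fun sigma : coloring (clique_join q N) q =>
     eps * N%:R < #|unblocked r sigma|%:R)) @ \oo --> (0 : R))%classic.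
Proof.
move=> rq br e0.
pose C := (q ^ q.-1)%:R * expR (coef_norm1 beta) / expR (- coef_norm1 beta).
apply: (@squeeze_cvgr _ _ _ _ (cst 0) (geometric C (expR (coef beta r)))).
- near=> N; rewrite Prob_ge0 //=; apply: Prob_unblocked_le => //; first exact: ltW.
  (* Once [N >= 1 / eps], the event forces more than one unblocked vertex. *)
  move=> sigma; rewrite -(ltr_nat R); apply: le_lt_trans.
  rewrite mulrC -ler_pdivrMr // mul1r; near: N; exact: nbhs_infty_ger.
- exact: cvg_cst.
- by apply: cvg_geometric; rewrite ger0_norm ?expR_ge0 // expR_lt1.
Unshelve. all: by end_near. Qed.

(* Both errors cannot be small at the same coloring, while the colorings with
   color 0 on the leaves keep a probability bounded below for either parameter. *)
Lemma not_consistent_at_both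
    (est : forall N, coloring (clique_join q N) q -> 'rV[R]_q.-1) beta1 beta2 :
  (forall s, coef beta1 s <= 0) -> (forall s, coef beta2 s <= 0) ->
  beta1 != beta2 -> consistent_at est beta1 -> ~ consistent_at est beta2.
Proof.
(* With a third of the distance, two errors of at most [eps] at one coloring would violate the
   triangle inequality. *)
move=> b1 b2 b12; pose eps := `|beta1 - beta2| / 3.
have e0 : 0 < eps by rewrite divr_gt0 // normr_gt0 subr_eq0.
move=> /(_ eps e0) cv1 /(_ eps e0) cv2.
pose c beta : R := expR (- coef_norm1 beta) / (q ^ q.-1)%:R.
have c0 beta : 0 < c beta.
  by rewrite divr_gt0 ?expR_gt0 // ltr0n expn_gt0 (ltnW hq).
(* The sum of the two error probabilities tends to 0, yet for every [N] one of them is at least its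
   own [c]. *)
suff : Num.min (c beta1) (c beta2) <= 0.
  by rewrite ge_min leNgt c0 leNgt c0.
rewrite -[leRHS]addr0; apply: (cvgr_to_ge (cvgD cv1 cv2)).
near=> N; have [sigma l0] := @exists_coloring_leaf0 q N hq.
have [E1|E1] := ltP eps `|est N sigma - beta1|.
  rewrite -[leLHS]addr0 lerD ?Prob_ge0 //.
  by rewrite ge_min (Prob_leaf0_ge hq _ _ sigma).
have E2 : eps < `|est N sigma - beta2|.
  have := ler_distD (est N sigma) beta1 beta2; rewrite (distrC beta1 (est N sigma)).
  move: e0 E1; rewrite /eps; lra.
rewrite -[leLHS]add0r lerD ?Prob_ge0 //.
by rewrite ge_min (Prob_leaf0_ge hq beta2 _ sigma) // orbT.
Unshelve. all: by end_near. Qed.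

End Asymptotics.

Theorem mainTheorem7 (R : realType) (q : nat) (hq : (2 <= q)%N) :
  [/\ exists C : R, forall N : nat, (1 <= N)%N ->
        avg_degree R (clique_join q N) <= C,
      forall beta : 'rV[R]_q.-1, coef beta 1 < 0 ->
        forall eps : R, 0 < eps < 1 ->
        limn_esup (fun N : nat =>
          (Prob beta (fun sigma : coloring (clique_join q N) q =>
             eps * N%:R < #|unblocked 1 sigma|%:R))%:E) = 0%E
    & forall r : nat, (1 <= r <= q.-1)%N ->
        ~ exists est : forall N : nat, coloring (clique_join q N) q -> 'rV[R]_q.-1,
            forall beta : 'rV[R]_q.-1, coef beta r < 0 ->
              consistent_at est beta].
Proof.
split.
- by exists (q.-1 * 2)%:R => N _; exact: avg_degree_clique_join_le.
- move=> beta b1 eps /andP[e0 _].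
  apply: (cvg_limn_einf_sup _).2; apply: cvg_EFin; first exact: nearW.
  exact: Prob_unblocked_cvg0.
- move=> r rq [est cons].
  have rq' : (r.-1 < q.-1)%N by lia.
  (* Only color [r] gets a nonzero coefficient, so [b 1] and [b 2] satisfy both beta_r < 0 and beta
     <= 0. *)
  pose b (a : R) : 'rV[R]_q.-1 := - a *: delta_mx 0 (Ordinal rq').
  have bE a s : coef (b a) s = if s == r then - a else 0.
    case: s => [|s] /=; first by case: eqP rq => // <-.
    (* Out of range [coef] takes its default 0, which is right because [r] is in range. *)
    case: insubP => [i _ is_|] /=; last first.
      by move=> sq; case: eqP => // sr; move: sq; rewrite -ltnNge; lia.
    rewrite !mxE eqxx /= -val_eqE /= is_.
    have -> : (s == r.-1) = (s.+1 == r) by lia.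
    by case: eqP => _; rewrite ?mulr1 ?mulr0.
  have b0 (a : R) : 0 <= a -> forall s, coef (b a) s <= 0.
    by move=> a0 s; rewrite bE; case: eqP; rewrite ?oppr_le0.
  apply: (not_consistent_at_both R q hq est (b 1) (b 2)).
  + exact: b0.
  + exact: b0.
  + apply/eqP => /(congr1 (fun x => coef x r)); rewrite !bE eqxx; lra.
  + by apply: cons; rewrite bE eqxx; lra.
  + by apply: cons; rewrite bE eqxx; lra.
Qed.
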